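(* Let $F(x,y,z,w)=\sum_{n\ge0}\sum_{\pi\in\mathbf I_n(3412)}x^ny^{\mathrm{inv}(\pi)}z^{\mathrm{des}(\pi)}w^{\mathrm{fix}(\pi)}$. Then $$F(x,y,z,w)=\frac{1}{1-xw-x^2yz+x^2yz^2-x^2yz^2F(xy^2,y,z,w)}=\cfrac{1}{1+b_0-\cfrac{c_0}{1+b_1-\cfrac{c_1}{1+b_2-\cfrac{c_2}{1+\cdots}}}}$$ where $b_i=-xy^{2i}w-x^2y^{4i+1}z+x^2y^{4i+1}z^2$ and $c_i=x^2y^{4i+1}z^2$ for $i\ge0$.
   Context: $\mathbf I_n(3412)$ is the set of involutions of $\{1,\dots,n\}$ with no subsequence order-isomorphic to $3412$ ($\mathbf I_0$ contains the empty involution). $\mathrm{inv}(\pi)$ is the number of pairs $i<j$ with $\pi_i>\pi_j$, $\mathrm{des}(\pi)$ the number of $i$ with $\pi_i>\pi_{i+1}$, $\mathrm{fix}(\pi)$ the number of fixed points. *)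

(* Defs.v *)
From HB Require Import structures.
From mathcomp Require Import all_boot all_order all_algebra all_fingroup.
From mathcomp Require Import boolp.
From mathcomp Require Import mpoly.

Set Implicit Arguments.
Unset Strict Implicit.
Unset Printing Implicit Defensive.

Import GRing.Theory.
Local Open Scope ring_scope.

(* Formal power series in one variable: fps R is R[[x]], with the Cauchy
   product; the units are the series whose constant coefficient is a unit.
   As everywhere in ssralg, f^-1 = f when f is not a unit. *)

Record fps (R : Type) := Fps { fps_coef : nat -> R }.

HB.instance Definition _ (R : Type) := gen_eqMixin (fps R).
HB.instance Definition _ (R : Type) := gen_choiceMixin (fps R).

Lemma fpsP (R : Type) (f g : fps R) : fps_coef f =1 fps_coef g <-> f = g.
Proof.
split=> [|-> //]; case: f g => [f] [g] /= fg.
by congr Fps; apply: functional_extensionality_dep.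
Qed.

Section FpsZmod.
Context (R : zmodType).
Implicit Types f g h : fps R.

Definition fps_zero : fps R := Fps (fun=> 0).
Definition fps_opp f : fps R := Fps (fun n => - fps_coef f n).
Definition fps_add f g : fps R := Fps (fun n => fps_coef f n + fps_coef g n).

Fact fps_addA : associative fps_add.
Proof. by move=> f g h; apply/fpsP => n; rewrite /= addrA. Qed.
Fact fps_addC : commutative fps_add.
Proof. by move=> f g; apply/fpsP => n; rewrite /= addrC. Qed.
Fact fps_add0 : left_id fps_zero fps_add.
Proof. by move=> f; apply/fpsP => n; rewrite /= add0r. Qed.
Fact fps_addN : left_inverse fps_zero fps_opp fps_add.
Proof. by move=> f; apply/fpsP => n; rewrite /= addNr. Qed.

HB.instance Definition _ :=
  GRing.isZmodule.Build (fps R) fps_addA fps_addC fps_add0 fps_addN.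
End FpsZmod.

Section FpsRing.
Context (R : comNzRingType).
Implicit Types f g h : fps R.

Definition fpsC (a : R) : fps R := Fps (fun n => if n == 0%N then a else 0).
Definition fpsX : fps R := Fps (fun n => (n == 1%N)%:R).
Definition fps_mul f g : fps R :=
  Fps (fun n => \sum_(i < n.+1) fps_coef f i * fps_coef g (n - i)%N).

Fact fps_mulC : commutative fps_mul.
Proof.
move=> f g; apply/fpsP => n /=; rewrite (reindex_inj rev_ord_inj) /=.
by apply: eq_bigr => i _; rewrite mulrC subSS subKn // -ltnS ltn_ord.
Qed.

Fact fps_mulA : associative fps_mul.
Proof.
have coef_rev f g n : fps_coef (fps_mul f g) n =
    \sum_(i < n.+1) fps_coef f (n - i)%N * fps_coef g i.
  by rewrite fps_mulC; apply: eq_bigr => i _; rewrite mulrC.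
move=> f g h; apply/fpsP => i; rewrite [RHS]coef_rev /=.
pose coef3 j k := fps_coef f j * (fps_coef g (i - j - k)%N * fps_coef h k).
transitivity (\sum_(j < i.+1) \sum_(k < i.+1 | (k <= i - j)%N) coef3 j k).
  apply: eq_bigr => /= j _.
  rewrite -[X in _ * X]/(fps_coef (fps_mul g h) (i - j)) coef_rev big_distrr /=.
  by rewrite (big_ord_narrow_leq (leq_subr _ _)).
rewrite (exchange_big_dep predT) //=; apply: eq_bigr => k _.
transitivity (\sum_(j < i.+1 | (j <= i - k)%N) coef3 j k).
  apply: eq_bigl => j; rewrite -ltnS -(ltnS j) -!subSn ?leq_ord //.
  by rewrite -subn_gt0 -(subn_gt0 j) -!subnDA addnC.
rewrite (big_ord_narrow_leq (leq_subr _ _)) big_distrl /=.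
by apply: eq_bigr => j _; rewrite /coef3 -!subnDA addnC mulrA.
Qed.

Fact fps_mul1 : left_id (fpsC 1) fps_mul.
Proof.
move=> f; apply/fpsP => n; rewrite /= big_ord_recl /= mul1r subn0 big1 ?addr0 //.
by move=> i _; rewrite mul0r.
Qed.

Fact fps_mulDl : left_distributive fps_mul (@fps_add R).
Proof.
move=> f g h; apply/fpsP => n; rewrite /= -big_split /=.
by apply: eq_bigr => i _; rewrite mulrDl.
Qed.

Fact fps_one_neq0 : fpsC 1 != 0 :> fps R.
Proof.
apply/eqP => /fpsP/(_ 0%N) /= e; by move: (oner_neq0 R); rewrite e eqxx.
Qed.

HB.instance Definition _ := GRing.Zmodule_isComNzRing.Build (fps R)
  fps_mulA fps_mulC fps_mul1 fps_mulDl fps_one_neq0.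

Lemma fps_coefM f g n :
  fps_coef (f * g) n = \sum_(i < n.+1) fps_coef f i * fps_coef g (n - i)%N.
Proof. by []. Qed.

(* The composite f(g), meaningful when g has constant coefficient 0: then g^k
   has no term of degree < k, so the sum over k may be cut at k = n. *)
Definition fps_comp f g : fps R :=
  Fps (fun n => \sum_(k < n.+1) fps_coef f k * fps_coef (g ^+ k) n).

(* Convergence for the x-adic topology (with R discrete). *)
Definition fps_cvg (u : nat -> fps R) f : Prop :=
  forall n, exists M, forall m, (M <= m)%N -> fps_coef (u m) n = fps_coef f n.
End FpsRing.

Section FpsUnit.
Context (R : comUnitRingType).
Implicit Types f g h : fps R.

Definition fps_unit : {pred fps R} :=
  fun f => fps_coef f 0 \is a GRing.unit.

(* The coefficients of degree < n of the inverse. *)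
Fixpoint fps_invs f (n : nat) : seq R :=
  if n is m.+1 then
    let s := fps_invs f m in
    rcons s ((fps_coef f 0)^-1 *
      ((m == 0%N)%:R - \sum_(i < m) s`_i * fps_coef f (m - i)%N))
  else [::].

Definition fps_inv f : fps R :=
  if f \in fps_unit then Fps (fun n => (fps_invs f n.+1)`_n) else f.

Lemma size_fps_invs f n : size (fps_invs f n) = n.
Proof. by elim: n => //= n IHn; rewrite size_rcons IHn. Qed.

Lemma nth_fps_invs f n i : (i < n)%N -> (fps_invs f n)`_i = (fps_invs f i.+1)`_i.
Proof.
elim: n => // n IHn; rewrite ltnS leq_eqVlt => /orP[/eqP-> //|lt_in].
by rewrite [in LHS]/= nth_rcons size_fps_invs lt_in IHn.
Qed.

Fact fps_mulV : {in fps_unit, left_inverse 1 fps_inv *%R}.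
Proof.
move=> f fU; apply/fpsP => n; rewrite fps_coefM /fps_inv fU.
rewrite big_ord_recr /= subnn nth_rcons size_fps_invs ltnn eqxx.
rewrite mulrAC mulVr // mul1r.
under eq_bigr => i _ do rewrite -[rcons _ _]/(fps_invs f i.+1) -(nth_fps_invs f (ltn_ord i)).
by rewrite addrC subrK; case: n => [|n].
Qed.

Fact fps_unitPl f g : g * f = 1 -> fps_unit f.
Proof.
move/fpsP/(_ 0%N); rewrite fps_coefM big_ord1 /= => gf1.
by apply/unitrPr; exists (fps_coef g 0); rewrite mulrC.
Qed.

Fact fps_inv_out : {in [predC fps_unit], fps_inv =1 id}.
Proof. by move=> f; rewrite inE /= /fps_inv => /negbTE ->. Qed.

HB.instance Definition _ := GRing.ComNzRing_hasMulInverse.Build (fps R)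
  fps_mulV fps_unitPl fps_inv_out.

Lemma fps_unitE f :
  (f \is a GRing.unit) = (fps_coef f 0 \is a GRing.unit).
Proof. by []. Qed.

(* The denominator
     1 + b_i - c_i / (1 + b_{i+1} - c_{i+1} / ( ... / (1 + b_{i+m}))). *)
Fixpoint cfrac_den (b c : nat -> fps R) (m i : nat) : fps R :=
  if m is m'.+1 then 1 + b i - c i / cfrac_den b c m' i.+1 else 1 + b i.

(* f = 1/(1 + b_0 - c_0/(1 + b_1 - c_1/(1 + b_2 - ...))): every denominator of
   every convergent is invertible and the convergents tend to f. *)
Definition is_cfrac (b c : nat -> fps R) f : Prop :=
  (forall m i, cfrac_den b c m i \is a GRing.unit) /\
  fps_cvg (fun m => 1 / cfrac_den b c m 0) f.
End FpsUnit.

(* Permutations of {1, ..., n} are 'S_n, with 'I_n = {0, ..., n-1}. *)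

Definition involution n (s : 'S_n) : bool := [forall i, s (s i) == i].

(* s has a subsequence s_(f 0), s_(f 1), ... (f increasing) which is
   order-isomorphic to the word p. *)
Definition contains (p : seq nat) n (s : 'S_n) : bool :=
  [exists f : {ffun 'I_(size p) -> 'I_n},
    [forall a : 'I_(size p), forall b : 'I_(size p),
      ((a < b)%N ==> (f a < f b)%N) &&
      ((s (f a) < s (f b))%N == (nth 0 p a < nth 0 p b)%N)]].

Definition I3412 n : {set 'S_n} :=
  [set s : 'S_n | involution s && ~~ contains [:: 3; 4; 1; 2]%N s].

Definition inv n (s : 'S_n) : nat :=
  #|[set ij : 'I_n * 'I_n | (ij.1 < ij.2)%N && (s ij.2 < s ij.1)%N]|.

Definition des n (s : 'S_n) : nat :=
  #|[set i : 'I_n | [exists j : 'I_n, (j == i.+1 :> nat) && (s j < s i)%N]]|.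

Definition fixpts n (s : 'S_n) : nat := #|[set i : 'I_n | s i == i]|.

(* Generating functions live in Z[y,z,w][[x]]. *)
Notation Zyzw := {mpoly int[3]}.

Definition ypol : Zyzw := 'X_(inord 0).
Definition zpol : Zyzw := 'X_(inord 1).
Definition wpol : Zyzw := 'X_(inord 2).

Definition x : fps Zyzw := fpsX Zyzw.
Definition y : fps Zyzw := fpsC ypol.
Definition z : fps Zyzw := fpsC zpol.
Definition w : fps Zyzw := fpsC wpol.

Definition F : fps Zyzw :=
  Fps (fun n => \sum_(s in I3412 n)
    ypol ^+ inv s * zpol ^+ des s * wpol ^+ fixpts s).

Definition b_ (i : nat) : fps Zyzw :=
  - (x * y ^+ (2 * i)%N * w) - x ^+ 2 * y ^+ (4 * i + 1)%N * z
  + x ^+ 2 * y ^+ (4 * i + 1)%N * z ^+ 2.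

Definition c_ (i : nat) : fps Zyzw := x ^+ 2 * y ^+ (4 * i + 1)%N * z ^+ 2.

(* Main.v *)
(** An involution of [{0, ..., n-1}] is handled as the word [u] of its values.
    If it avoids 3412 and exchanges [0] and [a], then [{0, ..., a}] is stable, so
    the word splits uniquely as [b (+) v], where the block [b] is either a fixed
    point or a 3412-avoiding involution [u'] of size [m] enclosed by the
    transposition of its two end points. Enclosing adds [2m + 1] inversions and
    1 or 2 descents according to whether [m = 0], while all three statistics are
    additive over [(+)]. Hence [F = 1 + B F] with
    [B = xw + x^2 y (z + z^2 (F(x y^2) - 1))], which is the functional equation.
    Substituting [x y^(2i)] for [x] and iterating gives the continued fraction:
    each level multiplies the error by [x^2]. *)

Require Import Defs.
From HB Require Import structures.
From mathcomp Require Import all_boot all_order all_algebra all_fingroup.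
From mathcomp Require Import mpoly zify ring.

Set Implicit Arguments.
Unset Strict Implicit.
Unset Printing Implicit Defensive.

Import GRing.Theory.

(** * Words of involutions, direct sums and nesting *)

Definition has3412 (u : seq nat) : Prop := exists i j k l,
  [/\ [&& i < j, j < k, k < l & l < size u],
      nth 0 u k < nth 0 u l, nth 0 u l < nth 0 u i & nth 0 u i < nth 0 u j].

Definition inv_word (u : seq nat) : Prop :=
  (forall i, i < size u -> nth 0 u i < size u) /\
  (forall i, i < size u -> nth 0 u (nth 0 u i) = i).

Definition inv3412 (u : seq nat) : Prop := inv_word u /\ ~ has3412 u.

Definition oplus (u v : seq nat) : seq nat := u ++ map (addn (size u)) v.
Definition nest (u : seq nat) : seq nat := (size u).+1 :: rcons (map S u) 0.

Lemma size_oplus u v : size (oplus u v) = size u + size v.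
Proof. by rewrite size_cat size_map. Qed.

Lemma size_nest u : size (nest u) = (size u).+2.
Proof. by rewrite /= size_rcons size_map. Qed.

Lemma nth_oplusl u v i : i < size u -> nth 0 (oplus u v) i = nth 0 u i.
Proof. by move=> iu; rewrite nth_cat iu. Qed.

Lemma nth_oplusr u v i :
  i < size v -> nth 0 (oplus u v) (size u + i) = size u + nth 0 v i.
Proof.
by move=> iv; rewrite nth_cat ltnNge leq_addr /= addKn (nth_map 0).
Qed.

Lemma nth_oplusr_sub u v i : size u <= i < size u + size v ->
  nth 0 (oplus u v) i = size u + nth 0 v (i - size u).
Proof. by move=> iv; rewrite -nth_oplusr; [congr nth|]; lia. Qed.

Lemma nth_nest u i : i < size u -> nth 0 (nest u) i.+1 = (nth 0 u i).+1.
Proof. by move=> iu; rewrite /= nth_rcons size_map iu (nth_map 0). Qed.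

Lemma nth_nest_last u : nth 0 (nest u) (size u).+1 = 0.
Proof. by rewrite /= nth_rcons size_map ltnn eqxx. Qed.

(** In 3412 the last letter is below the first, while all letters coming from [v] exceed those of
    [u]. So an occurrence that starts in [u] also ends in [u], and every occurrence lies in a single
    summand. *)
Lemma inv3412_oplus u v : inv3412 u -> inv3412 v -> inv3412 (oplus u v).
Proof.
move=> [[ru iu] au] [[rv iv] av]; split.
  split=> i; rewrite size_oplus => hi.
    case: (ltnP i (size u)) => h; first by rewrite nth_oplusl //; have := ru _ h; lia.
    by rewrite nth_oplusr_sub; [have := rv (i - size u) _|]; lia.
  case: (ltnP i (size u)) => h.
    by rewrite (nth_oplusl _ h) nth_oplusl ?ru // iu.
  rewrite (@nth_oplusr_sub _ _ i); last by lia.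
  by rewrite nth_oplusr ?rv ?iv; lia.
case=> i [j [k [l]]]; rewrite size_oplus => -[/and4P[ij jk kl lt] h1 h2 h3].
have lo q : q < size u -> nth 0 (oplus u v) q < size u.
  by move=> h; rewrite nth_oplusl ?ru.
have hi q : size u <= q -> q < size u + size v -> size u <= nth 0 (oplus u v) q.
  by move=> h h'; rewrite nth_oplusr_sub; lia.
case: (ltnP i (size u)) => hiu.
  have lu : l < size u.
    case: (ltnP l (size u)) => // h.
    by have := lo _ hiu; have := hi _ h lt; lia.
  apply: au; exists i, j, k, l; rewrite !nth_oplusl in h1 h2 h3 *; try lia.
  by split=> //; lia.
apply: av; exists (i - size u), (j - size u), (k - size u), (l - size u).
by rewrite !nth_oplusr_sub in h1 h2 h3; try lia; split; lia.
Qed.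

Lemma inv3412_oplus_inv u v : (forall i, i < size u -> nth 0 u i < size u) ->
  inv3412 (oplus u v) -> inv3412 u /\ inv3412 v.
Proof.
move=> ru [[r i] a]; rewrite size_oplus in r i.
have iu q : q < size u -> nth 0 u (nth 0 u q) = q.
  move=> h; have := i q; rewrite (nth_oplusl _ h) nth_oplusl ?ru //; apply; lia.
split; split.
- by split.
- case=> p [j [k [l [h h1 h2 h3]]]]; apply: a; exists p, j, k, l.
  rewrite !nth_oplusl ?size_oplus; try lia.
  by split=> //; lia.
- have rv q : q < size v -> nth 0 v q < size v.
    by move=> h; have := r (size u + q); rewrite nth_oplusr //; lia.
  split=> // q h; have := i (size u + q); rewrite nth_oplusr // nth_oplusr ?rv //; lia.
- case=> p [j [k [l [h h1 h2 h3]]]]; apply: a.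
  exists (size u + p), (size u + j), (size u + k), (size u + l).
  by rewrite !nth_oplusr ?size_oplus; try lia; split; lia.
Qed.

(** The first position could only serve as the 3, which needs a larger letter to its right, but it
    carries the maximum. The last could only serve as the 2, which needs a smaller letter, but it
    carries 0. Any occurrence is therefore interior. *)
Lemma inv3412_nest u : inv3412 u -> inv3412 (nest u).
Proof.
move=> [[r i] a]; split.
  split=> [|] [|q]; rewrite size_nest => h.
  - by [].
  - case: (ltnP q (size u)) => hq; first by rewrite nth_nest // !ltnS ltnW ?r.
    by rewrite (_ : q = size u) ?nth_nest_last //; lia.
  - exact: nth_nest_last.
  - case: (ltnP q (size u)) => hq; first by rewrite nth_nest // nth_nest ?i ?r.
    by rewrite (_ : q = size u) ?nth_nest_last //; lia.
have bd q : nth 0 (nest u) q <= (size u).+1.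
  case: q => [|q] //; case: (ltngtP q (size u)) => [hq|hq|->].
  - by rewrite nth_nest // ltnS ltnW ?r.
  - by rewrite nth_default // size_nest; lia.
  - by rewrite nth_nest_last.
case=> -[|p] [[|j] [[|k] [[|l]]]]; rewrite size_nest.
all: move=> -[/and4P[pj jk kl lt] h1 h2 h3] //.
  by have := bd j.+1; rewrite -[X in X < _]/((size u).+1) in h3; lia.
have lu : l < size u.
  rewrite ltn_neqAle; apply/andP; split; last by lia.
  by apply/eqP=> e; move: h1; rewrite e nth_nest_last.
apply: a; exists p, j, k, l.
rewrite !nth_nest in h1 h2 h3; try lia.
by split; lia.
Qed.

Lemma inv3412_nest_inv u : inv3412 (nest u) -> inv3412 u.
Proof.
move=> [[r i] a]; rewrite size_nest in r i.
have r' q : q < size u -> nth 0 u q < size u.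
  move=> h; have := r q.+1; rewrite nth_nest // => h'.
  (* The range bound alone leaves [nth 0 u q = size u] possible. Then involutivity would force the
     last letter of [nest u] to be [q.+1], but it is 0. *)
  rewrite ltn_neqAle; apply/andP; split; last by lia.
  apply/eqP => e; have := i q.+1; rewrite nth_nest // e nth_nest_last; lia.
split.
  split=> // q h; have := i q.+1; rewrite nth_nest // nth_nest ?r' //; lia.
case=> p [j [k [l [h h1 h2 h3]]]]; apply: a.
exists p.+1, j.+1, k.+1, l.+1; rewrite size_nest !nth_nest; try lia.
by split; lia.
Qed.

(** * Small words and the splitting off of the first block *)

Lemma inv3412_nil : inv3412 [::].
Proof. by split=> // -[i [j [k [l [h]]]]]; rewrite /= in h; lia. Qed.

Lemma inv3412_1 : inv3412 [:: 0].
Proof.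
split; first by split=> -[].
by case=> i [j [k [l [h]]]]; rewrite /= in h; lia.
Qed.

(* If the first letter is [a], then [0 < i < a < u_i] would make the letters in
   positions [0, i, a, u_i] spell 3412; so [{0, ..., a}] is stable. *)
Lemma inv3412_first_block u i : inv3412 u -> i < size u ->
  (nth 0 u i <= nth 0 u 0) = (i <= nth 0 u 0).
Proof.
move=> [[r iv] a] lti.
have le q : q < size u -> q <= nth 0 u 0 -> nth 0 u q <= nth 0 u 0.
  move=> hq; have s0 : 0 < size u by lia.
  case: q hq => [|q] // hq; rewrite leq_eqVlt => /orP[/eqP e|lt].
    by rewrite [X in nth 0 u X]e iv.
  case: (leqP (nth 0 u q.+1) (nth 0 u 0)) => // h; case: a.
  exists 0, q.+1, (nth 0 u 0), (nth 0 u q.+1).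
  by rewrite !iv // !r // h lt.
apply/idP/idP=> h; last exact: le.
by rewrite -(iv i) // le ?r.
Qed.

(** The cut comes just after position [a], the image of 0. The condition on the first letter of [b]
    records this, and later makes the decomposition unique. *)
Lemma inv3412_split u : inv3412 u -> 0 < size u ->
  exists b v, [/\ u = oplus b v, inv3412 b, inv3412 v, 0 < size b &
                  nth 0 b 0 = (size b).-1].
Proof.
move=> hu s0; set a := nth 0 u 0.
have sa : a < size u by case: hu => -[r _] _; apply: r.
have sb : size (take a.+1 u) = a.+1 by rewrite size_takel.
(* The truncated subtraction is exact, since the letters after position [a] all exceed [a]. *)
have E : u = oplus (take a.+1 u) [seq i - a.+1 | i <- drop a.+1 u].
  rewrite -[LHS](cat_take_drop a.+1) /oplus; congr cat.
  rewrite -map_comp -[LHS]map_id; apply/eq_in_map => q /(nthP 0)[j].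
  rewrite size_drop nth_drop => hj <- /=; rewrite sb subnKC //.
  have lt : a.+1 + j < size u by rewrite -ltn_subRL.
  by rewrite ltnNge (inv3412_first_block hu lt) -/a -ltnNge ltnS leq_addr.
exists (take a.+1 u), [seq i - a.+1 | i <- drop a.+1 u].
have [//||h1 h2] := @inv3412_oplus_inv (take a.+1 u) [seq i - a.+1 | i <- drop a.+1 u].
- move=> i; rewrite sb => hi; rewrite nth_take // ltnS.
  by rewrite (inv3412_first_block hu) //; apply: leq_trans hi sa.
- by rewrite -E.
- by rewrite sb nth_take.
Qed.

(** As 0 is sent to the last position, the last letter is 0 and no interior letter is. The interior
    letters can thus be lowered by one without loss, which exhibits the word nested inside. *)
Lemma inv3412_block b : inv3412 b -> 0 < size b -> nth 0 b 0 = (size b).-1 ->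
  b = [:: 0] \/ exists2 u, inv3412 u & b = nest u.
Proof.
case: b => // a t hb _ /= ea; move: hb; rewrite {a}ea => hb.
case: (lastP t) hb => [|t' q] hb; first by left.
right; move: hb; rewrite size_rcons.
set m := size t'; set b := (_ :: _) => hb.
have sb : size b = m.+2 by rewrite /b /= size_rcons.
have [[r iv] _] := hb.
have q0 : q = 0.
  have := iv 0; rewrite sb /= => /(_ isT).
  by rewrite nth_rcons ltnn eqxx.
have nz : forall j, j < m -> 0 < nth 0 t' j.
  move=> j hj; rewrite lt0n; apply/eqP => e.
  by have := iv j.+1; rewrite sb /= nth_rcons hj e /= !ltnS => /(_ (ltnW hj)); lia.
have E : b = nest (map predn t').
  rewrite /b q0 /nest size_map; congr (_ :: rcons _ _).
  rewrite -map_comp -[LHS]map_id; apply/eq_in_map => j /(nthP 0)[i hi <-] /=.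
  by rewrite prednK ?nz.
by exists (map predn t') => //; apply: inv3412_nest_inv; rewrite -E.
Qed.

(** * The three statistics on words *)

Fixpoint winv (u : seq nat) : nat :=
  if u is a :: v then count (fun b => b < a) v + winv v else 0.

(** The default [a] of [head] makes the last letter contribute nothing. *)
Fixpoint wdes (u : seq nat) : nat :=
  if u is a :: v then (head a v < a) + wdes v else 0.

(* The letters of [u] are in positions [k], [k + 1], ... *)
Fixpoint wfix (k : nat) (u : seq nat) : nat :=
  if u is a :: v then (a == k) + wfix k.+1 v else 0.

Lemma winv_cat u v : {in u & v, forall a b, a <= b} ->
  winv (u ++ v) = winv u + winv v.
Proof.
elim: u => //= a u IHu le_uv; rewrite count_cat IHu; last first.
  by move=> c b cu bv; apply: le_uv => //; rewrite inE cu orbT.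
rewrite (_ : count _ v = 0) ?addn0 ?addnA //.
apply/eqP; rewrite -leqn0 leqNgt -has_count; apply/hasPn => b bv /=.
by rewrite -leqNgt le_uv ?mem_head.
Qed.

Lemma wdes_cat u v : {in u & v, forall a b, a <= b} ->
  wdes (u ++ v) = wdes u + wdes v.
Proof.
elim: u => //= a u IHu le_uv; rewrite IHu; last first.
  by move=> c b cu bv; apply: le_uv => //; rewrite inE cu orbT.
rewrite addnA; congr (_ + _ + _); case: u le_uv {IHu} => //= le_uv.
rewrite ltnn; case: v le_uv => [|b v] /= le_uv; first by rewrite ltnn.
by rewrite ltnNge le_uv ?mem_head.
Qed.

Lemma wfix_cat k u v : wfix k (u ++ v) = wfix k u + wfix (k + size u) v.
Proof.
elim: u k => [|a u IHu] k /=; first by rewrite addn0.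
by rewrite IHu addnA addSnnS.
Qed.

Lemma winv_shift d u : winv (map (addn d) u) = winv u.
Proof.
elim: u => //= a u ->; rewrite count_map; congr addn.
by apply: eq_count => b /=; rewrite ltn_add2l.
Qed.

Lemma wdes_shift d u : wdes (map (addn d) u) = wdes u.
Proof.
by elim: u => //= a u ->; case: u => [|b u] /=; rewrite ?ltnn ?ltn_add2l.
Qed.

Lemma wfix_shift d k u : wfix (d + k) (map (addn d) u) = wfix k u.
Proof. by elim: u k => //= a u IHu k; rewrite eqn_add2l -addnS IHu. Qed.

Lemma winv_rcons0 u : winv (rcons (map S u) 0) = winv u + size u.
Proof.
elim: u => //= a u ->; rewrite -cats1 count_cat count_map /=.
by rewrite (eq_count (a2 := fun b => b < a)) //; lia.
Qed.

Lemma wdes_rcons0 u : wdes (rcons (map S u) 0) = wdes u + (0 < size u).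
Proof.
elim: u => //= a u ->; case: u => [|b u] /=; first by rewrite ltnn.
by rewrite ltnS addnA.
Qed.

(** Letters and positions are raised together, and the appended 0 stands at a positive position, so
    it is not fixed. *)
Lemma wfix_rcons0 k u : wfix k.+1 (rcons (map S u) 0) = wfix k u.
Proof. by elim: u k => //= a u IHu k; rewrite eqSS IHu. Qed.

Lemma inv_word_lt u a : inv_word u -> a \in u -> a < size u.
Proof. by case=> r _ /(nthP 0)[i hi <-]; apply: r. Qed.

(** The first letter exceeds the [(size u).+1] letters after it, and the final 0 is below the
    [size u] interior ones. *)
Lemma winv_nest u : inv_word u -> winv (nest u) = winv u + (2 * size u + 1).
Proof.
move=> wu; rewrite /= winv_rcons0 (_ : count _ _ = (size u).+1); first by lia.
rewrite -cats1 count_cat count_map /= addn0 addn1; congr S.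
apply/eqP; rewrite -all_count; apply/allP => a au.
exact: (inv_word_lt wu au).
Qed.

(** The first letter always starts a descent. The step down to the final 0 is a second one exactly
    when there is an interior. *)
Lemma wdes_nest u : inv_word u -> wdes (nest u) = wdes u + (0 < size u).+1.
Proof.
move=> wu; rewrite /= wdes_rcons0 (_ : head _ _ < _ = true); first by lia.
by case: u wu => [|a u] wu //=; apply: (inv_word_lt wu (mem_head _ _)).
Qed.

Lemma wfix_nest u : wfix 0 (nest u) = wfix 0 u.
Proof. by rewrite /= wfix_rcons0. Qed.

Lemma oplus_le u v : inv_word u ->
  {in u & map (addn (size u)) v, forall a b, a <= b}.
Proof. by move=> wu a b /(inv_word_lt wu) au /mapP[c _ ->]; lia. Qed.

Lemma winv_oplus u v : inv_word u -> winv (oplus u v) = winv u + winv v.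
Proof. by move=> wu; rewrite winv_cat ?winv_shift //; apply: oplus_le. Qed.

Lemma wdes_oplus u v : inv_word u -> wdes (oplus u v) = wdes u + wdes v.
Proof. by move=> wu; rewrite wdes_cat ?wdes_shift //; apply: oplus_le. Qed.

Lemma wfix_oplus u v : wfix 0 (oplus u v) = wfix 0 u + wfix 0 v.
Proof. by rewrite wfix_cat addnC add0n -{1}[size u]addn0 wfix_shift addnC. Qed.

Lemma count_nth_sum (a : pred nat) u :
  count a u = \sum_(0 <= i < size u) a (nth 0 u i).
Proof.
rewrite -sum1_count big_mkcond (big_nth 0) /=.
by apply: eq_bigr => i _; case: a.
Qed.

Lemma winvE u : winv u = \sum_(0 <= i < size u) \sum_(0 <= j < size u)
  ((i < j) && (nth 0 u j < nth 0 u i)).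
Proof.
elim: u => [|a u IHu]; first by rewrite big_geq.
rewrite /= big_nat_recl // big_nat_recl //= add0n count_nth_sum; congr addn.
by rewrite IHu; apply: eq_bigr => i _; rewrite big_nat_recl.
Qed.

(** The guard on [i.+1] prevents the default letter 0 past the end from creating a spurious
    descent. *)
Lemma wdesE u : wdes u = \sum_(0 <= i < size u)
  ((i.+1 < size u) && (nth 0 u i.+1 < nth 0 u i)).
Proof.
elim: u => [|a u IHu]; first by rewrite big_geq.
rewrite /= big_nat_recl //= IHu; congr addn.
by case: u {IHu} => //=; rewrite ltnn.
Qed.

Lemma wfixE k u : wfix k u = \sum_(0 <= i < size u) (nth 0 u i == k + i).
Proof.
elim: u k => [|a u IHu] k; first by rewrite big_geq.
rewrite /= big_nat_recl //= IHu addn0; congr addn.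
by apply: eq_bigr => i _; rewrite addnS.
Qed.

(** * Translation between permutations and words *)

Definition word n (s : 'S_n) : seq nat := [seq val (s i) | i <- enum 'I_n].

Lemma size_word n (s : 'S_n) : size (word s) = n.
Proof. by rewrite size_map size_enum_ord. Qed.

Lemma nth_word n (s : 'S_n) (i : 'I_n) : nth 0 (word s) i = s i.
Proof. by rewrite (nth_map i) ?size_enum_ord // nth_ord_enum. Qed.

Lemma word_inj n : injective (@word n).
Proof.
by move=> s t e; apply/permP => i; apply: val_inj; rewrite /= -!nth_word e.
Qed.

Lemma card_sum_bool (T : finType) (P : pred T) :
  #|[set i | P i]| = \sum_i (P i : nat).
Proof.
rewrite -sum1_card big_mkcond; apply: eq_bigr => i _.
by rewrite inE; case: (P i).
Qed.

Lemma winv_word n (s : 'S_n) : winv (word s) = Defs.inv s.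
Proof.
rewrite /Defs.inv card_sum_bool winvE size_word big_mkord.
rewrite -(pair_bigA _ (fun i j : 'I_n => ((i < j) && (s j < s i) : nat))) /=.
by apply: eq_bigr => i _; rewrite big_mkord; apply: eq_bigr => j _; rewrite !nth_word.
Qed.

Lemma wdes_word n (s : 'S_n) : wdes (word s) = des s.
Proof.
rewrite /des card_sum_bool wdesE size_word big_mkord; apply: eq_bigr => i _.
congr nat_of_bool; apply/andP/existsP => [[lt h]|[j /andP[/eqP e h]]].
  exists (Ordinal lt); rewrite /= eqxx /=.
  by move: h; rewrite nth_word -[i.+1]/(val (Ordinal lt)) nth_word.
by rewrite -e ltn_ord !nth_word.
Qed.

Lemma wfix_word n (s : 'S_n) : wfix 0 (word s) = fixpts s.
Proof.
rewrite /fixpts card_sum_bool wfixE size_word big_mkord; apply: eq_bigr => i _.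
by rewrite nth_word.
Qed.

(** The letters 1, 2, 3, 4 of the pattern stand at its positions 2, 3, 0, 1, so the chain of three
    inequalities in [has3412] settles all comparisons required by order-isomorphism. *)
Lemma containsP n (s : 'S_n) :
  reflect (has3412 (word s)) (contains [:: 3; 4; 1; 2] s).
Proof.
apply: (iffP existsP) => [[f /forallP H]|[i [j [k [l]]]]].
  have E (a b : 'I_(size [:: 3; 4; 1; 2])) : (a < b -> f a < f b) /\
      (s (f a) < s (f b)) = (nth 0 [:: 3; 4; 1; 2] a < nth 0 [:: 3; 4; 1; 2] b).
    by have /forallP/(_ b)/andP[/implyP h /eqP h'] := H a.
  pose o q (h : q < 4) : 'I_(size [:: 3; 4; 1; 2]) := Ordinal h.
  pose i := o 0 isT; pose j := o 1 isT; pose k := o 2 isT; pose l := o 3 isT.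
  exists (f i), (f j), (f k), (f l); rewrite !nth_word size_word ltn_ord.
  rewrite (E i j).1 // (E j k).1 // (E k l).1 //.
  by rewrite (E k l).2 (E l i).2 (E i j).2.
rewrite size_word => -[/and4P[ij jk kl ln]].
have kn := ltn_trans kl ln; have jn := ltn_trans jk kn; have iN := ltn_trans ij jn.
pose o q (h : q < n) : 'I_n := Ordinal h.
have ow q (h : q < n) : nth 0 (word s) q = s (o q h) by rewrite -nth_word.
rewrite (ow _ iN) (ow _ jn) (ow _ kn) (ow _ ln) => h1 h2 h3.
exists [ffun a : 'I_4 => nth (o i iN) [:: o i iN; o j jn; o k kn; o l ln] a].
apply/forallP => -[[|[|[|[|a]]]] ha] //; apply/forallP => -[[|[|[|[|b]]]] hb] //;
  rewrite !ffunE; apply/andP; split; rewrite /= ?ltnn //=; lia.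
Qed.

Lemma word_inv3412 n (s : 'S_n) : inv3412 (word s) <-> s \in I3412 n.
Proof.
rewrite inE; split=> [[[_ iv] a]|/andP[/forallP iv /containsP a]].
  apply/andP; split; last exact/containsP.
  apply/forallP => i; apply/eqP/val_inj => /=.
  by have := iv i; rewrite size_word !nth_word; apply.
split=> //; split=> i; rewrite size_word => hi.
  by rewrite -[i]/(val (Ordinal hi)) nth_word.
by rewrite -[i]/(val (Ordinal hi)) !nth_word (eqP (iv _)).
Qed.

Lemma inv_word_perm u : inv_word u -> exists s : 'S_(size u), word s = u.
Proof.
move=> [r iv]; pose f (i : 'I_(size u)) := Ordinal (r i (ltn_ord i)).
have fI : injective f.
  move=> i j /(congr1 val) /= e; apply: val_inj.
  by rewrite /= -(iv i) // e iv.
exists (perm fI); apply: (@eq_from_nth _ 0); rewrite size_word // => i hi.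
by rewrite -[i]/(val (Ordinal hi)) nth_word permE.
Qed.

(** * Enumeration of the words by their first block *)

Definition words n : seq (seq nat) := [seq word s | s in I3412 n].

Lemma mem_words n u : u \in words n <-> size u = n /\ inv3412 u.
Proof.
split=> [/imageP[s hs ->]|[<- hu]].
  by rewrite size_word; split=> //; apply/word_inv3412.
have [s es] := inv_word_perm (proj1 hu).
by apply/imageP; exists s => //; apply/word_inv3412; rewrite es.
Qed.

Lemma uniq_words n : uniq (words n).
Proof. by rewrite map_inj_uniq ?enum_uniq //; apply: word_inj. Qed.

(* The possible first blocks of a word of length [n.+1]. *)
Definition blocks n : seq (seq nat) :=
  [:: 0] :: [seq nest u | m <- iota 0 n, u <- words m].

Lemma nest_inj : injective nest.
Proof.
by move=> u v [_ /rcons_inj[/inj_map-> //]]; apply: succn_inj.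
Qed.

Lemma mem_blocks n b : b \in blocks n <->
  [/\ inv3412 b, 0 < size b <= n.+1 & nth 0 b 0 = (size b).-1].
Proof.
rewrite inE; split=> [/orP[/eqP->|/allpairsPdep[m [u []]]]|[hb /andP[b0 bn] eb]].
- by split=> //; apply: inv3412_1.
- rewrite mem_iota => /andP[_ hm] /mem_words[su hu] ->; rewrite -su add0n in hm.
  by rewrite size_nest; split=> //; apply: inv3412_nest.
have [->|[u hu eu]] := inv3412_block hb b0 eb; first by rewrite eqxx.
apply/orP; right; apply/allpairsPdep; exists (size u), u; split=> //.
  by rewrite mem_iota; move: bn; rewrite eu size_nest; lia.
by apply/mem_words.
Qed.

Lemma uniq_blocks n : uniq (blocks n).
Proof.
rewrite cons_uniq; apply/andP; split.
  by apply/allpairsPdep => -[m [u [_ _ []]]]; case: u.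
apply: allpairs_uniq_dep; [exact: iota_uniq | by move=> m _; apply: uniq_words|].
move=> _ _ /allpairsPdep[m [u [_ hu ->]]] /allpairsPdep[p [v [_ hv ->]]] /=.
move/nest_inj => e; case/mem_words: hu => hu _; case/mem_words: hv => hv _.
by move: hu hv; rewrite e => -> ->.
Qed.

Lemma words_rec n : perm_eq (words n.+1)
  [seq oplus b v | b <- blocks n, v <- words (n.+1 - size b)].
Proof.
apply: uniq_perm; first exact: uniq_words.
  apply: allpairs_uniq_dep; [exact: uniq_blocks | by move=> b _; apply: uniq_words|].
  move=> _ _ /allpairsPdep[b [u [hb _ ->]]] /allpairsPdep[c [v [hc _ ->]]] /=.
  case/mem_blocks: hb => _ /andP[b0 _] eb; case/mem_blocks: hc => _ /andP[c0 _] ec e.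
  (* Uniqueness of the cut: the first letter of the whole word is the size of its first block minus
     one. *)
  have sz : size b = size c.
    have := congr1 (fun t => nth 0 t 0) e; rewrite /= !nth_oplusl // eb ec => h.
    by rewrite -(prednK b0) -(prednK c0) h.
  move/eqP: e; rewrite eqseq_cat // => /andP[/eqP-> /eqP].
  by move/(inj_map (@addnI _)) ->.
move=> u; apply/idP/allpairsPdep => [/mem_words[su hu]|[b [v [hb hv ->]]]].
  have [|b [v [eu hb hv b0 eb]]] := inv3412_split hu; first by rewrite su.
  have sz := size_oplus b v; rewrite -eu su in sz.
  exists b, v; split=> //; first by apply/mem_blocks; rewrite b0 sz leq_addr.
  by apply/mem_words; rewrite sz addKn.
case/mem_blocks: hb => hb /andP[_ hs] _; case/mem_words: hv => sv hv.
by apply/mem_words; split; [rewrite size_oplus sv subnKC | apply: inv3412_oplus].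
Qed.

Local Open Scope ring_scope.

(** * Power series: coefficients and rescaling of the variable *)

Section FpsExtra.
Context (R : comNzRingType).
Implicit Types (f g : fps R) (a b : R).

Lemma fps_coefD f g n : fps_coef (f + g) n = fps_coef f n + fps_coef g n.
Proof. by []. Qed.

Lemma fps_coefB f g n : fps_coef (f - g) n = fps_coef f n - fps_coef g n.
Proof. by []. Qed.

Lemma fps_coef0M f g : fps_coef (f * g) 0 = fps_coef f 0 * fps_coef g 0.
Proof. by rewrite fps_coefM big_ord1. Qed.

Lemma fps_coefCM a f n : fps_coef (fpsC a * f) n = a * fps_coef f n.
Proof.
rewrite fps_coefM big_ord_recl /= subn0 big1 ?addr0 // => i _.
by rewrite mul0r.
Qed.

Lemma fps_coefXM f n :
  fps_coef (fpsX R * f) n = if n is m.+1 then fps_coef f m else 0.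
Proof.
rewrite fps_coefM big_ord_recl /= mul0r add0r.
case: n => [|n]; first by rewrite big_ord0.
rewrite big_ord_recl /= mul1r subn1 big1 ?addr0 // => i _.
by rewrite mul0r.
Qed.

Lemma fps_coefXnM f k n :
  fps_coef (fpsX R ^+ k * f) n = if (n < k)%N then 0 else fps_coef f (n - k).
Proof.
elim: k n => [|k IHk] n; first by rewrite mul1r subn0.
by rewrite exprS -mulrA fps_coefXM; case: n => // n; rewrite IHk.
Qed.

Lemma fpsCM a b : fpsC (a * b) = fpsC a * fpsC b.
Proof. by apply/fpsP => n; rewrite fps_coefCM /=; case: n => //=; rewrite mulr0. Qed.

Lemma fpsCX a n : fpsC (a ^+ n) = fpsC a ^+ n.
Proof. by elim: n => // n IHn; rewrite !exprS fpsCM IHn. Qed.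

(** The substitution of [a x] for [x], given on coefficients so that it is easily a ring
    morphism. *)
Definition fps_scale a f : fps R := Fps (fun n => fps_coef f n * a ^+ n).

Fact fps_scale_is_zmod_morphism a : zmod_morphism (fps_scale a).
Proof. by move=> f g; apply/fpsP => n; rewrite /= mulrBl. Qed.

Fact fps_scale_is_monoid_morphism a : monoid_morphism (fps_scale a).
Proof.
split=> [|f g]; apply/fpsP => n.
  by case: n => [|n] /=; rewrite ?mulr1 ?mul0r.
rewrite [LHS]/= !fps_coefM mulr_suml; apply: eq_bigr => i _ /=.
by rewrite mulrACA -exprD subnKC // -ltnS.
Qed.

HB.instance Definition _ a := GRing.isZmodMorphism.Build (fps R) (fps R)
  (fps_scale a) (fps_scale_is_zmod_morphism a).
HB.instance Definition _ a := GRing.isMonoidMorphism.Build (fps R) (fps R)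
  (fps_scale a) (fps_scale_is_monoid_morphism a).

Lemma fps_scaleX a : fps_scale a (fpsX R) = fpsX R * fpsC a.
Proof.
apply/fpsP => n; rewrite fps_coefXM /=.
by case: n => [|[|n]] /=; rewrite ?mul0r ?mul1r.
Qed.

Lemma fps_scaleC a b : fps_scale a (fpsC b) = fpsC b.
Proof. by apply/fpsP => -[|n] /=; rewrite ?mulr1 ?mul0r. Qed.

Lemma fps_scaleA a b f : fps_scale a (fps_scale b f) = fps_scale (a * b) f.
Proof. by apply/fpsP => n; rewrite /= -mulrA exprMn [b ^+ _ * _]mulrC. Qed.

Lemma fps_scale1 f : fps_scale 1 f = f.
Proof. by apply/fpsP => n; rewrite /= expr1n mulr1. Qed.

(** Powers of [a x] are monomials, so only the last term, [k = n], of the truncated sum survives. *)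
Lemma fps_comp_scale a f : fps_comp f (fpsX R * fpsC a) = fps_scale a f.
Proof.
apply/fpsP => n /=; rewrite big_ord_recr big1 /= ?add0r => [|i _].
  by rewrite exprMn -fpsCX fps_coefXnM ltnn subnn.
rewrite exprMn -fpsCX fps_coefXnM ltnNge ltnW //=.
by rewrite subn_eq0 leqNgt ltn_ord mulr0.
Qed.
End FpsExtra.

(** * Weights of words and the functional equation *)

Definition wt (u : seq nat) : Zyzw :=
  ypol ^+ winv u * zpol ^+ wdes u * wpol ^+ wfix 0 u.

Lemma wt_oplus u v : inv_word u -> wt (oplus u v) = wt u * wt v.
Proof.
move=> wu; rewrite /wt winv_oplus // wdes_oplus // wfix_oplus !exprD.
by ring.
Qed.

Lemma wt_nest u : inv_word u ->
  wt (nest u) = ypol ^+ (2 * size u + 1) * zpol ^+ (0 < size u).+1 * wt u.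
Proof.
move=> wu; rewrite /wt winv_nest // wdes_nest // wfix_nest !exprD.
by ring.
Qed.

Lemma coefF n : fps_coef F n = \sum_(u <- words n) wt u.
Proof.
rewrite /words big_image; apply: eq_bigr => s _.
by rewrite /wt winv_word wdes_word wfix_word.
Qed.

Local Opaque F.

(** Generating function of the first blocks by length: degree 1 is the fixed point, and degree
    [m.+2] collects the words [nest u] with [u] of size [m]. *)
Definition Fblock : fps Zyzw := Fps (fun n =>
  match n with
  | 0 => 0
  | 1 => wpol
  | m.+2 => ypol ^+ (2 * m + 1) * zpol ^+ (0 < m)%N.+1 * fps_coef F m
  end).

Lemma coefF0 : fps_coef F 0 = 1.
Proof.
rewrite coefF (perm_big [:: [::]]) ?big_seq1 ?/wt ?mulr1 //.
apply: uniq_perm => // [|u]; first exact: uniq_words.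
rewrite inE; apply/idP/eqP => [/mem_words[/size0nil]//|->].
by apply/mem_words; split=> //; apply: inv3412_nil.
Qed.

Lemma F_block : F = 1 + Fblock * F.
Proof.
apply/fpsP => -[|n].
  by rewrite coefF0 [RHS]/= big_ord1 mul0r addr0.
rewrite [RHS]/= add0r coefF (perm_big _ (words_rec n)) big_allpairs_dep /=.
(* The term of degree 0 of [Fblock] vanishes and that of degree 1 matches the block [[:: 0]] at the
   head of [blocks n]; the other terms match the nested blocks. *)
rewrite big_ord_recl /= mul0r add0r big_ord_recl /= subSS subn0.
have -> : \sum_(b <- blocks n) \sum_(v <- words (n.+1 - size b)) wt (oplus b v)
    = \sum_(b <- blocks n) wt b * fps_coef F (n.+1 - size b).
  apply: eq_big_seq => b /mem_blocks[[wb _] _ _].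
  by rewrite coefF mulr_sumr; apply: eq_bigr => v _; rewrite wt_oplus.
rewrite big_cons subSS subn0; congr (_ * _ + _).
  by rewrite /wt /= !expr0 !mul1r.
rewrite big_allpairs_dep /= -[in iota 0 n](subn0 n) big_mkord.
apply: eq_bigr => i _; rewrite subSS add0n -[bump 0 i]/(i.+1).
rewrite (coefF i) [X in _ = X * _]mulr_sumr [RHS]mulr_suml.
apply: eq_big_seq => u /mem_words[su [wu _]].
by rewrite wt_nest // size_rcons size_map su.
Qed.

(** The factor [ypol ^+ (2 * m)] in degree [m] rescales [F] to $F(xy^2)$. The terms with [z] and
    [- z ^+ 2] correct the block [[:: 1; 0]], which has one descent instead of two. *)
Lemma FblockE : Fblock = x * w + x ^+ 2 * y * z - x ^+ 2 * y * z ^+ 2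
  + x ^+ 2 * y * z ^+ 2 * fps_scale (ypol ^+ 2) F.
Proof.
(* Horner form in [x], so that coefficients are read off by removing one factor [x] at a time. *)
have -> : x * w + x ^+ 2 * y * z - x ^+ 2 * y * z ^+ 2
    + x ^+ 2 * y * z ^+ 2 * fps_scale (ypol ^+ 2) F
  = x * (w + x * (y * z * (1 + z * (fps_scale (ypol ^+ 2) F - 1)))).
  by ring.
apply/fpsP => -[|n]; rewrite fps_coefXM //.
rewrite -[RHS]/(fps_coef w n + fps_coef (x * _) n) fps_coefXM.
case: n => [|n]; first by rewrite addr0.
rewrite [fps_coef w _.+1]/= add0r /y /z -mulrA !fps_coefCM.
rewrite -[fps_coef (1 + _) n]/(fps_coef 1 n + fps_coef (fpsC zpol * _) n).
rewrite fps_coefCM; case: n => [|n].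
  by rewrite /= coefF0 !muln0 mul1r subrr mulr0 addr0 !mulr1 expr1.
by rewrite /= subr0 add0r -exprM exprD !expr2 !expr1; ring.
Qed.

Lemma F_functional : F * (1 - x * w - x ^+ 2 * y * z + x ^+ 2 * y * z ^+ 2
           - x ^+ 2 * y * z ^+ 2 * fps_scale (ypol ^+ 2) F) = 1.
Proof.
rewrite (_ : _ - _ = 1 - Fblock); last by rewrite FblockE; ring.
by rewrite mulrBr mulr1 mulrC {1}F_block mulrC addrK.
Qed.

(** * Iterated functional equation and the continued fraction *)

Definition Fshift i : fps Zyzw := fps_scale (ypol ^+ (2 * i)) F.

(** Rescaling [x] by $y^{2i}$ in the functional equation turns $x^2y$ into $x^2y^{4i+1}$ and
    $F(xy^2)$ into [Fshift i.+1]. Thus [Fshift i] is the value expected of the tail that starts at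
    level [i]. *)
Lemma Fshift_functional i :
  Fshift i * (1 + b_ i - c_ i * Fshift i.+1) = 1.
Proof.
have := congr1 (fps_scale (ypol ^+ (2 * i))) F_functional.
rewrite !(rmorphM, rmorphB, rmorphD, rmorphN, rmorphXn, rmorph1) /=.
rewrite fps_scaleA -exprD -mulnSr -/(Fshift i) -/(Fshift i.+1).
rewrite !fps_scaleX !fps_scaleC fpsCX -/x -/y => FE; rewrite -[RHS]FE {FE}.
rewrite /b_ /c_ (_ : y ^+ (4 * i + 1) = (y ^+ (2 * i)) ^+ 2 * y); last first.
  by rewrite -exprM -exprSr; congr (_ ^+ _); lia.
by rewrite -/z -/w; move: (y ^+ _) (Fshift _) (Fshift _) => p f g; ring.
Qed.

(** All [b_ i] and [c_ i] are multiples of [x]. *)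
Lemma cfrac_den_coef0 m i : fps_coef (cfrac_den b_ c_ m i) 0 = 1.
Proof.
have b0 : fps_coef (b_ i) 0 = 0.
  by rewrite /= /x !big_ord1 /= !mul0r; ring.
have c0 g : fps_coef (c_ i * g) 0 = 0.
  by rewrite /c_ expr2 -!mulrA fps_coef0M /= mul0r.
by case: m => [|m]; rewrite [cfrac_den _ _ _ _]/= ?fps_coefB fps_coefD b0 ?c0 ?subr0 addr0.
Qed.

Lemma cfrac_den_unit m i : cfrac_den b_ c_ m i \is a GRing.unit.
Proof. by rewrite fps_unitE cfrac_den_coef0 unitr1. Qed.

(** Compares the truncated denominator with the exact one, whose tail is [Fshift i.+1]. Only
    divisibility of the error matters, so [h] is left unspecified; each further level gains $x^2$
    from [c_ i]. *)
Lemma cfrac_den_error m i : exists h,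
  cfrac_den b_ c_ m i = 1 + b_ i - c_ i * Fshift i.+1 + (x ^+ 2) ^+ m.+1 * h.
Proof.
elim: m i => [|m IHm] i.
  (* At depth 0 the error is the whole omitted term [c_ i * Fshift i.+1]. *)
  exists (y ^+ (4 * i + 1) * z ^+ 2 * Fshift i.+1).
  by rewrite /= expr1 /c_; ring.
have [h eD] := IHm i.+1; set D := cfrac_den _ _ m i.+1 in eD *.
have DU : D / D = 1 by apply: divrr (cfrac_den_unit _ _).
set E := 1 + b_ i.+1 - _ in eD.
have FE : Fshift i.+1 * E = 1 by apply: Fshift_functional.
exists (y ^+ (4 * i + 1) * z ^+ 2 * h * Fshift i.+1 / D).
(* This is $D^{-1} = E^{-1} - (D-E)E^{-1}D^{-1}$ with $E^{-1}$ equal to [Fshift i.+1]. *)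
have DF : D^-1 = Fshift i.+1 - (x ^+ 2) ^+ m.+1 * h * Fshift i.+1 / D.
  have -> : (x ^+ 2) ^+ m.+1 * h = D - E by rewrite eD addrC addKr.
  rewrite mulrBl mulrBl [D * _]mulrC -[_ * D / D]mulrA DU mulr1.
  by rewrite [E * _]mulrC FE mul1r subKr.
rewrite [cfrac_den _ _ _ _]/= -/D {1}DF [_ ^+ m.+2]exprS /c_.
move: D^-1 (Fshift _) (_ ^+ m.+1) => d f q.
by ring.
Qed.

Theorem theorem3p4 :
  F = 1 / (1 - x * w - x ^+ 2 * y * z + x ^+ 2 * y * z ^+ 2
           - x ^+ 2 * y * z ^+ 2 * fps_comp F (x * y ^+ 2))
  /\ is_cfrac b_ c_ F.
Proof.
split.
  rewrite /y -fpsCX fps_comp_scale -/y.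
  set D := _ - _; have FD : F * D = 1 := F_functional.
  have DU : D \is a GRing.unit by apply/unitrPr; exists F; rewrite mulrC.
  by rewrite -FD mulrK.
split=> [|n]; first exact: cfrac_den_unit.
(* The error has order at least [2 * m.+1] in [x], which exceeds [n] once [n <= m]. *)
exists n => m le_nm; have [h] := cfrac_den_error m 0.
set D := cfrac_den _ _ _ _; set E := (1 + _ - _) => eD.
have DU : D / D = 1 by apply: divrr (cfrac_den_unit _ _).
have FE : F * E = 1.
  by rewrite -[F](fps_scale1); apply: (Fshift_functional 0).
(* The same difference of inverses as in the error estimate, now with $E^{-1} = F$. *)
have -> : 1 / D = F - x ^+ (2 * m.+1) * (h * F / D).
  rewrite exprM; have -> : (x ^+ 2) ^+ m.+1 * (h * F / D) = (D - E) * F / D.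
    by rewrite eD [_ + _ * h - _]addrC addKr; ring.
  by rewrite mulrBl mulrBl [D * _]mulrC -[F * D / D]mulrA DU mulr1
    [E * _]mulrC FE subKr.
by rewrite fps_coefB fps_coefXnM ifT ?subr0 //; lia.
Qed.
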